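(* Let $p>1$, let $\mathbf{\Omega}\subset \mathbf{X}\times\mathbf{Y}\subset\mathbb{R}^n\times\mathbb{R}^p$ be a compact set with nonempty interior, and let $\mu$ be a Borel measure on $\mathbf{\Omega}$ with $\mathbf{M}_t(\mu)\succ 0$ for all $t\in\mathbb{N}$ and with marginal $\phi$ on $\mathbf{X}$. Then for every $\mathbf{x}\in\mathbf{X}$ and every $t\in\mathbb{N}$ there exists a linear functional $\boldsymbol{\nu}_{\mathbf{x},t}$ on $\mathbb{R}[\mathbf{y}]_{2t}$ (not necessarily represented by a measure on $\mathbb{R}^p$), with $\mathbf{M}_t(\boldsymbol{\nu}_{\mathbf{x},t})\succ0$, such that $$\Lambda^\mu_t(\mathbf{x},\mathbf{y})\,=\,\Lambda^\phi_t(\mathbf{x})\cdot\Lambda^{\boldsymbol{\nu}_{\mathbf{x},t}}_t(\mathbf{y})\,,\qquad\forall\,\mathbf{x}\in\mathbf{X},\ \mathbf{y}\in\mathbb{R}^p.$$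
   Context: For $d,t\in\mathbb{N}$ let $\mathbb{N}^d_t=\{\boldsymbol{\alpha}\in\mathbb{N}^d:|\boldsymbol{\alpha}|=\sum_i\alpha_i\le t\}$, let $\mathbb{R}[\mathbf{z}]_t$ be the space of real polynomials of total degree at most $t$ in $\mathbf{z}=(z_1,\ldots,z_d)$, and let $\mathbf{v}_t(\mathbf{z})=(\mathbf{z}^{\boldsymbol{\alpha}})_{\boldsymbol{\alpha}\in\mathbb{N}^d_t}$ be the vector of monomials of degree at most $t$ (in some fixed order). For a linear functional $L$ on $\mathbb{R}[\mathbf{z}]_{2t}$, its moment matrix $\mathbf{M}_t(L)$ is the real symmetric matrix indexed by $\mathbb{N}^d_t$ with entries $L(\mathbf{z}^{\boldsymbol{\alpha}+\boldsymbol{\beta}})$. $\mathbf{A}\succ0$ means that $\mathbf{A}$ is positive definite. If $\mathbf{M}_t(L)\succ0$, the Christoffel function of $L$ of degree $t$ is $\Lambda^L_t(\mathbf{z})=\left[\mathbf{v}_t(\mathbf{z})^T\mathbf{M}_t(L)^{-1}\mathbf{v}_t(\mathbf{z})\right]^{-1}$, $\mathbf{z}\in\mathbb{R}^d$. For a Borel measure $\psi$ with finite moments, $\mathbf{M}_t(\psi)$ and $\Lambda^\psi_t$ denote these objects for the functional $q\mapsto\int q\,d\psi$. Here $\Lambda^\mu_t$ is taken with $d=n+p$ (variables $(\mathbf{x},\mathbf{y})$, total degree at most $t$), $\Lambda^\phi_t$ with $d=n$, and $\Lambda^{\boldsymbol{\nu}_{\mathbf{x},t}}_t$ with $d=p$.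 *)

(* Defs.v *)
From HB Require Import structures.
From mathcomp Require Import all_boot all_order all_algebra.
From mathcomp Require mpoly.

Set Implicit Arguments.
Unset Strict Implicit.
Unset Printing Implicit Defensive.

(* The notations of mpoly and of MathComp-Analysis are incompatible, so mpoly is
   imported only inside this module, before MathComp-Analysis is loaded. *)
Module BoundedPoly.
Import GRing.Theory mpoly.
Local Open Scope ring_scope.

(* msize q = deg q + 1, with msize 0 = 0. *)
Definition deg_le (R : comNzRingType) (d s : nat) : {pred {mpoly R[d]}} :=
  fun q => (msize q <= s.+1)%N.

Fact deg_le_submod_closed (R : comNzRingType) (d s : nat) :
  submod_closed (@deg_le R d s).
Proof.
split=> [|a u v]; first by rewrite unfold_in msize0.
rewrite !unfold_in => hu hv.
apply: (leq_trans (msizeD_le _ _)); rewrite geq_max hv andbT.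
exact: leq_trans (msizeZ_le _ _) hu.
Qed.

HB.instance Definition _ (R : comNzRingType) (d s : nat) :=
  GRing.isSubmodClosed.Build R {mpoly R[d]} (@deg_le R d s)
    (@deg_le_submod_closed R d s).

(* The space R[z_1, ..., z_d]_s of polynomials of total degree at most s. *)
Record bpoly (R : comNzRingType) (d s : nat) := BPoly {
  bpoly_val :> {mpoly R[d]};
  _ : bpoly_val \in @deg_le R d s }.

HB.instance Definition _ (R : comNzRingType) (d s : nat) :=
  [isSub for @bpoly_val R d s].
HB.instance Definition _ (R : comNzRingType) (d s : nat) :=
  [Choice of bpoly R d s by <:].
HB.instance Definition _ (R : comNzRingType) (d s : nat) :=
  [SubChoice_isSubLmodule of bpoly R d s by <:].

Definition bpoly_eval {R : comNzRingType} {d s : nat} (q : bpoly R d s)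
  (z : 'rV[R]_d) : R := (val q).@[fun i => z 0 i].

(* 'X_{1..d < t.+1} is the finite type of the multi-indices alpha with
   |alpha| <= t; enum fixes their order. *)
Notation nmon d t := #|{: bmultinom d t.+1}|.

Definition mindex {d t : nat} (i : 'I_(nmon d t)) : 'X_{1..d < t.+1} :=
  enum_val i.

Fact monomial2_subproof (R : comNzRingType) (d t : nat)
    (i j : 'I_(nmon d t)) :
  'X_[R, (mindex i + mindex j)%MM] \in @deg_le R d t.*2.
Proof.
rewrite unfold_in msizeX mdegD ltnS -addnn.
by apply: leq_add; rewrite -ltnS bmdeg.
Qed.

(* z^(alpha + beta), where alpha and beta are the i-th and j-th multi-indices. *)
Definition monomial2 (R : comNzRingType) (d t : nat) (i j : 'I_(nmon d t)) :
  bpoly R d t.*2 := BPoly (monomial2_subproof R i j).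

(* Used only for linear L. *)
Definition moment_matrix {R : comNzRingType} {d t : nat}
    (L : bpoly R d t.*2 -> R) : 'M[R]_(nmon d t) :=
  \matrix_(i, j) L (monomial2 R i j).

Definition monomials {R : comNzRingType} {d : nat} (t : nat) (z : 'rV[R]_d) :
  'cV[R]_(nmon d t) := \col_i 'X_[R, mindex i].@[fun k => z 0 k].

Definition posdefmx {R : realFieldType} {m : nat} (A : 'M[R]_m) : Prop :=
  A^T = A /\ forall u : 'cV[R]_m, u != 0 -> 0 < (u^T *m A *m u) 0 0.

(* Meaningful only when moment_matrix L is positive definite: invmx A = A when
   A is singular. *)
Definition christoffel {R : realFieldType} {d t : nat}
    (L : bpoly R d t.*2 -> R) (z : 'rV[R]_d) : R :=
  (((monomials t z)^T *m invmx (moment_matrix L) *m monomials t z) 0 0)^-1.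

End BoundedPoly.
Export BoundedPoly.

From mathcomp Require Import all_classical all_reals all_analysis.
Import Order.TTheory GRing.Theory Num.Theory numFieldNormedType.Exports.
Local Open Scope classical_set_scope.
Local Open Scope ring_scope.

Definition borel (R : realType) (d : nat) :=
  g_sigma_algebraType (@open 'rV[R]_d).

(* Rintegral is a total function; finite_moments psi makes the functional
   q |-> \int q dpsi below the actual integral, hence linear. *)
Definition finite_moments {R : realType} {d : nat}
    (psi : {measure set (borel R d) -> \bar R}) : Prop :=
  forall (s : nat) (q : bpoly R d s),
    psi.-integrable setT (EFin \o (bpoly_eval q : borel R d -> R)).

Definition moment_functional {R : realType} {d : nat}
    (psi : {measure set (borel R d) -> \bar R}) (s : nat)
    (q : bpoly R d s) : R :=
  Rintegral psi setT (bpoly_eval q).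

(* R^n x R^p is identified with R^(n + p) through row_mx, lsubmx and rsubmx. *)
Definition is_marginal {R : realType} {n p : nat}
    (mu : {measure set (borel R (n + p)) -> \bar R})
    (phi : {measure set (borel R n) -> \bar R}) : Prop :=
  forall A : set (borel R n), measurable A ->
    phi A = mu [set z | A (lsubmx (z : 'rV[R]_(n + p)))].

(* Main.v *)
Require Import Defs.
From HB Require Import structures.
From mathcomp Require Import all_boot all_order all_algebra.
From mathcomp Require Import ring lra.
From mathcomp Require mpoly.

Set Implicit Arguments.
Unset Strict Implicit.
Unset Printing Implicit Defensive.

Import Order.TTheory GRing.Theory Num.Theory.
Local Open Scope ring_scope.

(* Since v_t(x, y) = T_x v_t(y) for a matrix T_x with trivial kernel, the
   polynomial y |-> Lambda^phi_t(x) / Lambda^mu_t(x, y) has the positive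
   definite Gram matrix Q = Lambda^phi_t(x) T_x^T M_t(mu)^-1 T_x.  It remains to
   find a Hankel matrix M > 0 with v_t(y)^T M^-1 v_t(y) = v_t(y)^T Q v_t(y) for
   all y.  Take for M a maximizer of the determinant over the Hankel matrices
   M >= 0 with \tr (Q M) equal to the size N of M; this set is compact, and it
   contains a positive definite matrix, a multiple of the moment matrix of the
   y-marginal of mu.  Stationarity gives \tr (M^-1 A) = \tr (Q A) for all Hankel
   A, the Lagrange multiplier being 1 because both sides are N at A = M; then
   A = v_t(y) v_t(y)^T is the claim. *)

(** * Positive definite and semidefinite matrices over an ordered field *)

Section PosDef.
Variable R : realFieldType.

Definition semiposdefmx {m : nat} (A : 'M[R]_m) : Prop :=
  A^T = A /\ forall u : 'cV[R]_m, 0 <= (u^T *m A *m u) 0 0.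

Lemma form_addZ m (A : 'M[R]_m) (u w : 'cV[R]_m) e :
  ((u + e *: w)^T *m A *m (u + e *: w)) 0 0 =
  (u^T *m A *m u) 0 0 + e * ((u^T *m A *m w) 0 0 + (w^T *m A *m u) 0 0)
  + e ^+ 2 * (w^T *m A *m w) 0 0.
Proof.
have -> : (u + e *: w)^T = u^T + e *: w^T by apply/matrixP => i j; rewrite !mxE.
rewrite 2!mulmxDl !mulmxDr -!scalemxAl -!scalemxAr.
by rewrite !mxE; ring.
Qed.

Lemma posdefmx_semi m (A : 'M[R]_m) : posdefmx A -> semiposdefmx A.
Proof.
move=> [As Ap]; split=> // u; have [->|u0] := eqVneq u 0; last exact/ltW/Ap.
by rewrite mulmx0 mxE.
Qed.

Lemma posdefmx_unit m (A : 'M[R]_m) : posdefmx A -> A \in unitmx.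
Proof.
move=> [_ Ap]; rewrite unitmxE unitfE; apply/negP => /det0P[v v0 vA].
have vT0 : v^T != 0 by rewrite -trmx0 (inj_eq trmx_inj).
by have := Ap _ vT0; rewrite trmxK vA mul0mx mxE ltxx.
Qed.

Lemma mulmx_form_ge0 m (u : 'cV[R]_m) : 0 <= (u^T *m u) 0 0.
Proof. by rewrite mxE sumr_ge0// => i _; rewrite mxE -expr2 sqr_ge0. Qed.

Lemma mulmx_form_gt0 m (u : 'cV[R]_m) : u != 0 -> 0 < (u^T *m u) 0 0.
Proof.
move=> u0; rewrite lt_def mulmx_form_ge0 andbT; apply: contra u0 => /eqP.
rewrite mxE => /eqP; rewrite psumr_eq0; last by move=> i _; rewrite mxE -expr2 sqr_ge0.
move=> /allP u0; apply/eqP/matrixP => i j; rewrite ord1 mxE.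
by have := u0 i (mem_index_enum i); rewrite mxE -expr2 sqrf_eq0 => /eqP.
Qed.

Lemma posdefmx_congr m n (A : 'M[R]_n) (T : 'M[R]_(n, m)) :
  posdefmx A -> (forall u : 'cV_m, T *m u = 0 -> u = 0) ->
  posdefmx (T^T *m A *m T).
Proof.
move=> [As Ap] Tinj; split; first by rewrite !trmx_mul trmxK As mulmxA.
move=> u u0; have := Ap (T *m u); rewrite trmx_mul !mulmxA; apply.
by apply: contra u0 => /eqP/Tinj->.
Qed.

Lemma posdefmx_congr_unit m (A B : 'M[R]_m) :
  B \in unitmx -> posdefmx A -> posdefmx (B^T *m A *m B).
Proof.
move=> Bu Ap; apply: posdefmx_congr => // u.
by move/(congr1 (mulmx (invmx B))); rewrite mulKmx// mulmx0.
Qed.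

Lemma posdefmx_inv m (A : 'M[R]_m) : posdefmx A -> posdefmx (invmx A).
Proof.
move=> Ap; have Au := posdefmx_unit Ap.
have -> : invmx A = (invmx A)^T *m A *m invmx A.
  by rewrite -mulmxA mulmxV// mulmx1 trmx_inv Ap.1.
by apply: posdefmx_congr_unit => //; rewrite unitmx_inv.
Qed.

Lemma posdefmxZ m (A : 'M[R]_m) c : 0 < c -> posdefmx A -> posdefmx (c *: A).
Proof.
move=> c0 [As Ap]; split=> [|u u0]; first by rewrite linearZ/= As.
by rewrite -scalemxAr -scalemxAl mxE mulr_gt0// Ap.
Qed.

Lemma semiposdefmx_congr m n (A : 'M[R]_n) (T : 'M[R]_(n, m)) :
  semiposdefmx A -> semiposdefmx (T^T *m A *m T).
Proof.
move=> [As Ap]; split; first by rewrite !trmx_mul trmxK As mulmxA.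
by move=> u; have := Ap (T *m u); rewrite trmx_mul !mulmxA.
Qed.

Lemma semiposdefmx_unit m (A : 'M[R]_m) :
  semiposdefmx A -> A \in unitmx -> posdefmx A.
Proof.
move=> [As Ap] Au; split=> // u u0; rewrite lt_def Ap andbT.
apply: contra u0 => /eqP uAu.
have Au0 : A *m u = 0.
  (* Otherwise, for w = A u, the form at u - r w is negative for small r > 0. *)
  apply/eqP; apply: contraT => /mulmx_form_gt0 w_gt0.
  set w := A *m u in w_gt0.
  have uAw : u^T *m A = w^T by rewrite trmx_mul As.
  pose b := (w^T *m A *m w) 0 0; pose a := (w^T *m w) 0 0.
  have quad e : 0 <= 2 * e * a + e ^+ 2 * b.
    have := Ap (u + e *: w); rewrite form_addZ uAu uAw -mulmxA -/w -/a -/b.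
    by move=> /le_trans; apply; rewrite le_eqVlt; apply/orP; left; apply/eqP; ring.
  have b_ge0 : 0 <= b := Ap w.
  (* The quadratic is least at - a / b; the denominator b + 1 avoids a separate case b = 0. *)
  have := quad (- (a / (b + 1))).
  have d0 : 0 < b + 1 by lra.
  have -> : 2 * (- (a / (b + 1))) * a + (- (a / (b + 1))) ^+ 2 * b =
    - ((a / (b + 1)) ^+ 2 * (b + 2)) by field; rewrite gt_eqF.
  rewrite oppr_ge0 leNgt mulr_gt0//; last by lra.
  by rewrite exprn_gt0// divr_gt0.
by rewrite -(mulKmx Au u) Au0 mulmx0.
Qed.

Lemma form_delta m (A : 'M[R]_m) i j :
  ((delta_mx i 0 : 'cV_m)^T *m A *m (delta_mx j 0 : 'cV_m)) 0 0 = A i j.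
Proof. by rewrite trmx_delta -rowE -colE !mxE. Qed.

Lemma posdefmx_diag_gt0 m (A : 'M[R]_m) i : posdefmx A -> 0 < A i i.
Proof.
move=> [_ Ap]; rewrite -form_delta; apply: Ap.
apply/negP => /eqP/matrixP/(_ i 0); rewrite !mxE !eqxx => /eqP.
by rewrite oner_eq0.
Qed.

Lemma semiposdefmx_diag_ge0 m (A : 'M[R]_m) i : semiposdefmx A -> 0 <= A i i.
Proof. by move=> [_ Ap]; rewrite -form_delta. Qed.

(** The form at e_i + e_j and e_i - e_j gives 2 |A i j| <= A i i + A j j, and no diagonal entry
    exceeds the trace. This bounds the feasible set of the determinant maximization. *)
Lemma semiposdefmx_entry_le m (A : 'M[R]_m) i j :
  semiposdefmx A -> `|A i j| <= \tr A.
Proof.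
move=> Ap; have diag_le k : A k k <= \tr A.
  rewrite /mxtrace (bigD1 k)//= lerDl sumr_ge0// => l _.
  exact: semiposdefmx_diag_ge0.
have Aji : A j i = A i j by rewrite -{1}Ap.1 mxE.
have E e : 0 <= A i i + 2 * e * A i j + e ^+ 2 * A j j.
  have := Ap.2 (delta_mx i 0 + e *: delta_mx j 0).
  rewrite form_addZ !form_delta Aji => /le_trans; apply.
  by rewrite le_eqVlt; apply/orP; left; apply/eqP; ring.
have := E 1; have := E (-1); have := diag_le i; have := diag_le j.
by rewrite ler_norml; move=> *; apply/andP; split; lra.
Qed.

(** If s is the sum of all |A i j|, then |u^T A u| <= s u^T u, so d = 1 / (s + 1) works. Both signs
    of e are allowed, as the stationarity argument requires. *)
Lemma semiposdefmx_perturb m (A : 'M[R]_m) : A^T = A ->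
  exists2 d : R, 0 < d & forall e, `|e| <= d -> semiposdefmx (1%:M + e *: A).
Proof.
move=> As; pose s := \sum_i \sum_j `|A i j|.
have s_ge0 : 0 <= s by do 2 rewrite sumr_ge0// => ? _.
exists (s + 1)^-1; first by rewrite invr_gt0; lra.
move=> e he; split; first by rewrite linearD/= linearZ/= As trmx1.
move=> u; pose q := (u^T *m u) 0 0.
have q_ge0 : 0 <= q := mulmx_form_ge0 u.
have sq_le k : u k 0 ^+ 2 <= q.
  rewrite /q mxE (bigD1 k)//= mxE -expr2 lerDl sumr_ge0// => l _.
  by rewrite mxE -expr2 sqr_ge0.
have uu_le i j : `|u i 0 * u j 0| <= q.
  have := sq_le i; have := sq_le j.
  have := sqr_ge0 (u i 0 + u j 0); have := sqr_ge0 (u i 0 - u j 0).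
  rewrite ler_norml sqrrB sqrrD; move=> *; apply/andP; split; lra.
have uAu_le : `|(u^T *m A *m u) 0 0| <= s * q.
  rewrite mxE (le_trans (ler_norm_sum _ _ _))// /s exchange_big mulr_suml.
  apply: ler_sum => j _; rewrite mxE !mulr_suml (le_trans (ler_norm_sum _ _ _))//.
  apply: ler_sum => i _; rewrite mxE mulrAC mulrC normrM.
  by rewrite ler_wpM2l.
rewrite [leRHS](_ : _ = q + e * (u^T *m A *m u) 0 0); last first.
  by rewrite mulmxDr mulmxDl mulmx1 -scalemxAr -scalemxAl /q !mxE.
have : `|e * (u^T *m A *m u) 0 0| <= q.
  rewrite normrM (le_trans (ler_pM _ _ he uAu_le))// mulrA ler_piMl//.
  by rewrite mulrC ler_pdivrMr ?mul1r; lra.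
by rewrite ler_norml => /andP[]; lra.
Qed.

End PosDef.

(** * Cholesky factorization and the first-order expansion of the determinant *)

(** Induction on the size: a factor of the Schur complement of the top left entry extends to a block
    triangular factor of [A]. *)
Lemma posdefmx_cholesky (R : rcfType) m (A : 'M[R]_m) : posdefmx A ->
  exists2 B : 'M[R]_m, B \in unitmx & A = B^T *m B.
Proof.
suff H : posdefmx A -> exists B : 'M[R]_m, A = B^T *m B.
  move=> Ap; have [B AE] := H Ap; exists B => //.
  by have := posdefmx_unit Ap; rewrite AE unitmx_mul => /andP[].
elim: m A => [|m IHm] A Ap; first by exists 0; apply/matrixP; case.
pose a := A 0 0; have a_gt0 : 0 < a := posdefmx_diag_gt0 0 Ap.
have a0 : a != 0 by rewrite gt_eqF.
pose A' : 'M_(1 + m) := A.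
pose b : 'rV_m := ursubmx A'; pose C : 'M_m := drsubmx A'.
have AE : A = block_mx a%:M b b^T C :> 'M_(1 + m).
  rewrite -[LHS](@submxK _ 1 m 1 m); congr block_mx.
    by apply/matrixP => i j; rewrite !ord1 !mxE eqxx mulr1n; congr (A _ _); apply: val_inj.
  rewrite /b trmx_ursub; congr dlsubmx; exact/esym/Ap.1.
(* The columns of [T] span the [A]-orthogonal complement of the first basis vector, so T^T A T is
   the Schur complement, which is therefore positive definite. *)
pose T : 'M_(1 + m, m) := col_mx (- a^-1 *: b) 1%:M.
have Sp : posdefmx (C - a^-1 *: (b^T *m b)).
  have := @posdefmx_congr R m (1 + m) A T Ap.
  rewrite [X in posdefmx X](_ : _ = C - a^-1 *: (b^T *m b)).
    apply=> u; rewrite mul_col_mx mul1mx => /(congr1 dsubmx).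
    by rewrite col_mxKd linear0.
  rewrite AE /T tr_col_mx mul_row_block mul_row_col trmx1 !mul1mx mulmx1.
  rewrite [(_ *: b)^T]linearZ/= mul_mx_scalar scalerA mulrN divff// scaleN1r addrC.
  by rewrite [- _ + _]addrC subrr mul0mx addr0 addrC -scalemxAl scaleNr.
have [B' SE] := IHm _ Sp.
pose s := Num.sqrt a; have s2 : s * s = a by rewrite -expr2 sqr_sqrtr// ltW.
have s0 : s != 0 by apply: contraTneq a_gt0 => s0; rewrite -s2 s0 mul0r ltxx.
exists (block_mx s%:M (s^-1 *: b) 0 B' : 'M_(1 + m)).
rewrite [LHS]AE (@tr_block_mx _ 1 m 1 m) (@mulmx_block _ 1 m 1 m 1 m).
rewrite !trmx0 !mul0mx !mulmx0 !addr0.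
rewrite tr_scalar_mx !mul_scalar_mx scale_scalar_mx s2 scalerA divff// scale1r.
rewrite [(_ *: b)^T]linearZ/= mul_mx_scalar scalerA divff// scale1r -SE.
rewrite -scalemxAl -scalemxAr scalerA -invfM s2.
by rewrite addrC subrK.
Qed.

Lemma posdefmx_det_gt0 (R : rcfType) m (A : 'M[R]_m) : posdefmx A -> 0 < \det A.
Proof.
move=> Ap; have [B Bu ->] := posdefmx_cholesky Ap.
rewrite det_mulmx det_tr -expr2 exprn_even_gt0//=.
by rewrite -unitfE -unitmxE.
Qed.

(** For e != 0, 1 + e A = (- e) ((- e)^-1 - A), so the determinant is the reversed characteristic
    polynomial of [A] at - e. Having a polynomial as remainder makes it bounded near 0. *)
Lemma det_add1Z (R : fieldType) m (A : 'M[R]_m) :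
  exists r : {poly R}, forall e,
    \det (1%:M + e *: A) = 1 + e * \tr A + e ^+ 2 * r.[e].
Proof.
case: m A => [|m] A.
  by exists 0 => e; rewrite det_mx00 /mxtrace big_ord0 horner0 !mulr0 !addr0.
pose p := char_poly A.
have p_top : p`_m.+1 = 1.
  by have /monicP := char_poly_monic A; rewrite /lead_coef size_char_poly.
have p_tr : p`_m = - \tr A by rewrite (char_poly_trace A).
(* The two leading coefficients of [p] produce 1 and e * \tr A; the others, from degree m - 1
   downwards, form the remainder. *)
exists (\sum_(k < m) p`_(m.-1 - k) *: (- 'X) ^+ k) => e.
have [->|e0] := eqVneq e 0.
  by rewrite scale0r addr0 det1 mul0r expr0n mul0r !addr0.
have -> : 1%:M + e *: A = (- e) *: ((- e)^-1 %:M - A).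
  by rewrite scalerBr scale_scalar_mx divff ?oppr_eq0// scaleNr opprK.
rewrite detZ.
have -> : \det ((- e)^-1%:M - A) = p.[(- e)^-1].
  rewrite -horner_evalE -det_map_mx; congr (\det _); apply/matrixP => i j.
  by rewrite !mxE/= horner_evalE !hornerE hornerMn hornerX.
rewrite horner_coef size_char_poly mulr_sumr (reindex_inj rev_ord_inj)/=.
rewrite (eq_bigr (fun k : 'I_m.+2 => p`_(m.+1 - k) * (- e) ^+ k)); last first.
  move=> k _; rewrite subSS mulrCA; congr (_ * _).
  have ne0 : - e != 0 by rewrite oppr_eq0.
  rewrite exprVn -[in X in X / _](subnK (ltn_ord k : (k <= m.+1)%N)) addnC exprD.
  by rewrite mulfK// expf_neq0.
rewrite big_ord_recl big_ord_recl/= subn0 p_top expr0 mulr1.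
rewrite /bump/= add1n subSS subn0 p_tr expr1 mulrNN -addrA [\tr A * e]mulrC.
congr (_ + (_ + _)); rewrite horner_sum mulr_sumr; apply: eq_bigr => k _.
rewrite !add1n -[LHS]/(p`_(m.+1 - k.+2) * (- e) ^+ k.+2).
rewrite hornerZ horner_exp hornerN hornerX subSS subnS -subn1 subnAC subn1.
by rewrite -addn2 exprD sqrrN; ring.
Qed.

(** If a != 0, then e = k a gives 1 + k a^2 (1 + k r(e)), which exceeds 1 for small k > 0 because r
    is bounded on the disk of radius d. *)
Lemma critical_coef_eq0 (R : realFieldType) (r : {poly R}) (a d : R) : 0 < d ->
  (forall e, `|e| <= d -> 1 + e * a + e ^+ 2 * r.[e] <= 1) -> a = 0.
Proof.
move=> d0 H; apply/eqP; apply: contraT => a0.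
have [ub Hub] := poly_disk_bound r d.
have ub_ge0 : 0 <= ub by have := Hub 0; rewrite normr0 => /(_ (ltW d0)) /(le_trans _); apply.
(* The first bound keeps k a within the disk, the second makes k * ub < 1. *)
pose k := Num.min (d / `|a|) (ub + 1)^-1.
have k0 : 0 < k by rewrite lt_min divr_gt0 ?normr_gt0//= invr_gt0; lra.
have kd : `|k * a| <= d.
  rewrite normrM (gtr0_norm k0) -ler_pdivlMr ?normr_gt0//.
  by rewrite ge_min lexx.
have := H _ kd; have := Hub _ kd.
rewrite ler_norml => /andP[lo _].
have : k * ub < 1.
  have : k <= (ub + 1)^-1 by rewrite ge_min lexx orbT.
  by move=> /(ler_wpM2r ub_ge0) /le_lt_trans; apply; rewrite mulrC ltr_pdivrMr; lra.
set x := r.[_] in lo *.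
have -> : 1 + k * a * a + (k * a) ^+ 2 * x = 1 + (k * a ^+ 2) * (1 + k * x) by ring.
move=> kub; rewrite gerDl leNgt mulr_gt0//.
  by rewrite mulr_gt0// exprn_even_gt0.
have : k * - ub <= k * x by rewrite ler_pM2l.
by rewrite mulrN; lra.
Qed.

(** * Multi-indices, Hankel matrices and the specialization of x in v_t(x, y) *)

Module MultiIndex.
Import mpoly.

(* The substitution z_i := z_(f i) sends z^a to the monomial of exponent
   mnm_push f a. *)
Definition mnm_push d D (f : 'I_d -> 'I_D) (a : 'X_{1..d}) : 'X_{1..D} :=
  [multinom (\sum_(i | f i == k) a i)%N | k < D].

Lemma mdeg_push d D (f : 'I_d -> 'I_D) a : mdeg (mnm_push f a) = mdeg a.
Proof.
rewrite !mdegE (eq_bigr _ (fun k _ => mnmE _ k)).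
by rewrite [RHS](partition_big f predT).
Qed.

Lemma mnm_pushD d D (f : 'I_d -> 'I_D) a b :
  mnm_push f (a + b)%MM = (mnm_push f a + mnm_push f b)%MM.
Proof.
by apply/mnmP => k; rewrite mnmDE !mnmE -big_split; apply: eq_bigr => i _; rewrite mnmDE.
Qed.

Lemma meval_push (R : comNzRingType) d D (f : 'I_d -> 'I_D) a (v : 'I_D -> R) :
  'X_[R, mnm_push f a].@[v] = 'X_[R, a].@[fun i => v (f i)].
Proof.
rewrite !mevalX [RHS](partition_big f predT)//=; apply: eq_bigr => k _.
by rewrite mnmE expr_sum; apply: eq_bigr => i /eqP ->.
Qed.

Lemma mnm_push_inE d D (f : 'I_d -> 'I_D) a i : injective f -> mnm_push f a (f i) = a i.
Proof.
move=> finj; rewrite mnmE (bigD1 i)//= big1 ?addn0// => j /andP[/eqP/finj ->].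
by rewrite eqxx.
Qed.

Lemma mnm_push_inj d D (f : 'I_d -> 'I_D) : injective f -> injective (mnm_push f).
Proof.
by move=> finj a b ab; apply/mnmP => i; rewrite -!(mnm_push_inE _ i finj) ab.
Qed.

Fact mindex_push_subproof d D t (f : 'I_d -> 'I_D) (i : 'I_(nmon d t)) :
  (mdeg (mnm_push f (mindex i)) < t.+1)%N.
Proof. by rewrite mdeg_push bmdeg. Qed.

(** For [f] equal to [lshift] or [rshift], this locates the monomials in x alone, or in y alone,
    among those in (x, y), so that the moment matrix of a marginal becomes a principal submatrix. *)
Definition mindex_push d D t (f : 'I_d -> 'I_D) (i : 'I_(nmon d t)) :
  'I_(nmon D t) := enum_rank (BMultinom (mindex_push_subproof f i)).

Lemma mindex_pushE d D t (f : 'I_d -> 'I_D) (i : 'I_(nmon d t)) :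
  mindex (mindex_push f i) = mnm_push f (mindex i) :> 'X_{1..D}.
Proof. by rewrite /mindex enum_rankK. Qed.

Lemma mindex_inj d t (i j : 'I_(nmon d t)) :
  mindex i = mindex j :> 'X_{1..d} -> i = j.
Proof. by move/val_inj/enum_val_inj. Qed.

Lemma mindex_push_inj d D t (f : 'I_d -> 'I_D) : injective f ->
  injective (@mindex_push d D t f).
Proof.
move=> finj i j /(congr1 (fun k => mindex k : 'X_{1..D})).
by rewrite !mindex_pushE => /(mnm_push_inj finj)/mindex_inj.
Qed.

Lemma monomial2_push_eval (R : comNzRingType) d D t (f : 'I_d -> 'I_D)
    (i j : 'I_(nmon d t)) (z : 'rV[R]_D) :
  bpoly_eval (monomial2 R (mindex_push f i) (mindex_push f j)) z =
  bpoly_eval (monomial2 R i j) (\row_k z 0 (f k)).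
Proof.
rewrite /bpoly_eval /= !mindex_pushE -mnm_pushD meval_push.
by rewrite !mevalX; apply: eq_bigr => k _; rewrite mxE.
Qed.

(** The multivariate Hankel matrices, which are exactly the moment matrices of linear
    functionals. *)
Definition hankelmx (R : Type) d t (M : 'M[R]_(nmon d t)) :=
  forall i j k l, (mindex i + mindex j = mindex k + mindex l)%MM -> M i j = M k l.

Lemma hankelmx_moment_push (R : comNzRingType) d D t (f : 'I_d -> 'I_D)
    (L : bpoly R D t.*2 -> R) :
  hankelmx (mxsub (mindex_push f) (mindex_push f) (moment_matrix L)
            : 'M_(nmon d t)).
Proof.
move=> i j k l eq_mon; rewrite !mxE; congr L; apply: val_inj => /=.
by rewrite !mindex_pushE -!mnm_pushD eq_mon.
Qed.

Lemma hankelmx_tr (R : Type) d t (M : 'M[R]_(nmon d t)) : hankelmx M -> M^T = M.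
Proof. by move=> hM; apply/matrixP => i j; rewrite mxE; apply: hM; rewrite addmC. Qed.

(** The condition A i j = A k l is the vanishing of the trace of (E_ji - E_lk) A, with E the
    elementary matrices. This is the form in which [maxdet] takes its linear space. *)
Lemma hankelmx_trace_eqs (R : comNzRingType) d t :
  exists K : 'M[R]_(nmon d t) -> Prop,
    forall A, hankelmx A <-> forall k, K k -> \tr (k *m A) = 0.
Proof.
have trE (A : 'M[R]_(nmon d t)) i j : \tr (delta_mx j i *m A) = A i j.
  rewrite /mxtrace (bigD1 j)//= big1 ?addr0 => [|k kj].
    rewrite mxE (bigD1 i)//= big1 ?addr0 => [|l li]; rewrite mxE ?eqxx ?mul1r//.
    by rewrite (negbTE li) andbF mul0r.
  by rewrite mxE big1// => l _; rewrite mxE (negbTE kj) mul0r.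
exists (fun K => exists i j k l, (mindex i + mindex j = mindex k + mindex l)%MM /\
  K = delta_mx j i - delta_mx l k) => A.
split=> [Ah _ [i [j [k [l [e ->]]]]]|H i j k l e].
  by rewrite mulmxBl raddfB/= !trE (Ah _ _ _ _ e) subrr.
have := H _ (ex_intro _ i (ex_intro _ j (ex_intro _ k (ex_intro _ l (conj e erefl))))).
by rewrite mulmxBl raddfB/= !trE => /eqP; rewrite subr_eq0 => /eqP.
Qed.

(** The entries are the values y^(alpha + beta). This admits v_t(y) v_t(y)^T as a test matrix in the
    stationarity identity. *)
Lemma hankelmx_monomials (R : comNzRingType) d t (y : 'rV[R]_d) :
  hankelmx (monomials t y *m (monomials t y)^T).
Proof.
move=> i j k l e; rewrite !mxE !big_ord1 !mxE -!mevalM -!mpolyXD.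
by rewrite e.
Qed.

(* The coefficient of z^g is read off any entry (i, j) of M with
   alpha_i + alpha_j = g; the choice is immaterial when M is Hankel. *)
Section HankelFunctional.
Variables (R : comNzRingType) (d t : nat) (M : 'M[R]_(nmon d t)).

Definition hankel_coef (g : 'X_{1..d}) : R :=
  if [pick ij : 'I_(nmon d t) * 'I_(nmon d t) | (mindex ij.1 + mindex ij.2)%MM == g]
  is Some ij then M ij.1 ij.2 else 0.

Definition hankel_functional (q : bpoly R d t.*2) : R :=
  \sum_(g : 'X_{1..d < t.*2.+1}) (val q)@_g * hankel_coef g.

Fact hankel_functional_linear : linear_for *%R hankel_functional.
Proof.
move=> c q r; rewrite /hankel_functional mulr_sumr -big_split.
by apply: eq_bigr => g _; rewrite linearP/= mulrDl mulrA.
Qed.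

HB.instance Definition _ := GRing.isLinear.Build R (bpoly R d t.*2) R *%R
  hankel_functional hankel_functional_linear.

Lemma moment_matrix_hankel : hankelmx M -> moment_matrix hankel_functional = M.
Proof.
move=> hM; apply/matrixP => i j; rewrite mxE /hankel_functional/=.
set a := (mindex i + mindex j)%MM.
have a_deg : (mdeg a < t.*2.+1)%N.
  by rewrite mdegD ltnS -addnn leq_add// -ltnS bmdeg.
rewrite (bigD1 (BMultinom a_deg))//= big1 ?addr0 => [|g ga].
  rewrite mcoeffX eqxx mul1r /hankel_coef.
  (* The pair picked may differ from (i, j), but [M] has the same entry there by [hM]; the pick
     cannot fail, since (i, j) is a candidate. *)
  by case: pickP => [[k l] /= /eqP/hM//|/(_ (i, j))]; rewrite eqxx.
rewrite mcoeffX [_ == _]negbTE ?mul0r//; apply: contra ga => /eqP ag.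
by apply/eqP/val_inj.
Qed.

End HankelFunctional.

Section Specialize.
Variables (R : comNzRingType) (n p t : nat).

Definition mnm_l (a : 'X_{1..n + p}) : 'X_{1..n} := [multinom a (lshift p i) | i < n].
Definition mnm_r (a : 'X_{1..n + p}) : 'X_{1..p} := [multinom a (rshift n i) | i < p].

Lemma mdeg_mnm_r a : (mdeg (mnm_r a) <= mdeg a)%N.
Proof.
rewrite !mdegE big_split_ord/= (eq_bigr _ (fun k _ => mnmE _ k)).
exact: leq_addl.
Qed.

Lemma mnm_r_push a : mnm_r (mnm_push (@rshift n p) a) = a.
Proof.
by apply/mnmP => k; rewrite mnmE mnm_push_inE//; exact: rshift_inj.
Qed.

Lemma mnm_l_push a : mnm_l (mnm_push (@rshift n p) a) = 0%MM.
Proof.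
by apply/mnmP => k; rewrite !mnmE big1// => i; rewrite eq_rlshift.
Qed.

(* The matrix T_x with v_t(x, y) = T_x v_t(y). *)
Definition specialize_mx (x : 'rV[R]_n) : 'M[R]_(nmon (n + p) t, nmon p t) :=
  \matrix_(i, j) ('X_[R, mnm_l (mindex i)].@[fun k => x 0 k] *+
                  (mnm_r (mindex i) == mindex j)).

Lemma monomials_row_mx (x : 'rV[R]_n) (y : 'rV[R]_p) :
  monomials t (row_mx x y) = specialize_mx x *m monomials t y.
Proof.
apply/matrixP => i c; rewrite !mxE.
have r_deg : (mdeg (mnm_r (mindex i)) < t.+1)%N.
  by apply: leq_ltn_trans (mdeg_mnm_r _) (bmdeg _).
rewrite (bigD1 (enum_rank (BMultinom r_deg)))//= big1 ?addr0 => [|j jr].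
  rewrite !mxE /mindex !enum_rankK eqxx mulr1n -/(mindex i) !mevalX big_split_ord/=.
  by congr (_ * _); apply: eq_bigr => k _; rewrite mnmE ?row_mxEl ?row_mxEr.
rewrite mxE [_ == _]negbTE ?mulr0n ?mul0r//; apply: contra jr => /eqP jr.
by apply/eqP/mindex_inj; rewrite /mindex enum_rankK.
Qed.

(** Whatever x is, the row of T_x at the multi-index (0, beta) is the unit row at beta, so T_x
    contains an identity block. *)
Lemma specialize_mx_inj (x : 'rV[R]_n) (u : 'cV[R]_(nmon p t)) :
  specialize_mx x *m u = 0 -> u = 0.
Proof.
move=> /matrixP Tu; apply/matrixP => j c; have := Tu (mindex_push (@rshift n p) j) c.
rewrite !mxE (bigD1 j)//= big1 ?addr0 => [|k kj]; rewrite mxE mindex_pushE mnm_r_push.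
  by rewrite mnm_l_push eqxx mulr1n mpolyX0 meval1 mul1r.
rewrite [_ == _]negbTE ?mulr0n ?mul0r//; apply: contra kj => /eqP jk.
by apply/eqP/mindex_inj.
Qed.

End Specialize.

Lemma monomials_neq0 (R : comNzRingType) d t (z : 'rV[R]_d) : monomials t z != 0.
Proof.
apply/negP => /eqP/matrixP/(_ (enum_rank (@bm0 d t)) 0).
by rewrite !mxE /mindex enum_rankK mpolyX0 meval1 => /eqP; rewrite oner_eq0.
Qed.

End MultiIndex.
Export MultiIndex.

(** The submatrix is E^T A E for the selection matrix [E], whose kernel is trivial because [f] is
    injective. *)
Lemma posdefmx_mxsub (R : realFieldType) m n (f : 'I_m -> 'I_n) (A : 'M[R]_n) :
  injective f -> posdefmx A -> posdefmx (mxsub f f A).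
Proof.
move=> finj Ap; pose E : 'M[R]_(n, m) := \matrix_(k, i) (k == f i)%:R.
have -> : mxsub f f A = E^T *m A *m E.
  apply/matrixP => i j; rewrite !mxE (bigD1 (f j))//= big1 ?addr0 => [|k kj].
    rewrite !mxE eqxx mulr1 (bigD1 (f i))//= big1 ?addr0 => [|k ki].
      by rewrite !mxE eqxx mul1r.
    by rewrite !mxE (negbTE ki) mul0r.
  by rewrite [E _ _]mxE (negbTE kj) mulr0.
apply: posdefmx_congr => // u /matrixP Eu; apply/matrixP => i c.
have := Eu (f i) c; rewrite !mxE (bigD1 i)//= big1 ?addr0 => [|k ki].
  by rewrite mxE eqxx mul1r.
by rewrite mxE (inj_eq finj) eq_sym (negbTE ki) mul0r.
Qed.

Lemma christoffel_gt0 (R : realFieldType) d t (L : bpoly R d t.*2 -> R) z :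
  posdefmx (moment_matrix L) -> 0 < christoffel L z.
Proof.
by move=> Lp; rewrite invr_gt0; apply: (posdefmx_inv Lp).2; exact: monomials_neq0.
Qed.

From mathcomp Require Import all_classical all_reals all_analysis.
From mathcomp Require Import measurable_realfun.
Import Order.TTheory GRing.Theory Num.Theory numFieldNormedType.Exports.
Local Open Scope classical_set_scope.
Local Open Scope ring_scope.

(** * Continuity of matrix expressions, and determinant maximization over a linear space *)

Lemma continuous_sumr (R : realType) (T : topologicalType) (I : Type) (r : seq I)
    (F : I -> T -> R) :
  (forall i, continuous (F i)) -> continuous (fun x => \sum_(i <- r) F i x).
Proof.
move=> Fc; apply: continuous_big => //; exact: add_continuous.
Qed.

Lemma continuous_prodr (R : realType) (T : topologicalType) (I : Type) (r : seq I)
    (F : I -> T -> R) :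
  (forall i, continuous (F i)) -> continuous (fun x => \prod_(i <- r) F i x).
Proof.
move=> Fc; apply: continuous_big => //; exact: mul_continuous.
Qed.

Lemma continuous_det (R : realType) (T : topologicalType) m (F : T -> 'M[R]_m) :
  (forall i j, continuous (fun x => F x i j)) -> continuous (fun x => \det (F x)).
Proof.
move=> Fc; apply: continuous_sumr => s x; apply: cvgM; first exact: cvg_cst.
by apply: continuous_prodr => i; exact: Fc.
Qed.

Lemma continuous_mulmx (R : realType) (T : topologicalType) m n q
    (F : T -> 'M[R]_(m, n)) (G : T -> 'M[R]_(n, q)) :
  (forall i j, continuous (fun x => F x i j)) ->
  (forall i j, continuous (fun x => G x i j)) ->
  forall i j, continuous (fun x => (F x *m G x) i j).
Proof.
move=> Fc Gc i j.
rewrite (_ : (fun x => _) = fun x => \sum_k F x i k * G x k j).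
  by apply: continuous_sumr => k x; apply: cvgM; [exact: Fc|exact: Gc].
by apply/funext => x; rewrite mxE.
Qed.

Lemma closed_preimage_eq (R : realType) (T : topologicalType) (f : T -> R) (c : R) :
  continuous f -> closed [set x | f x = c].
Proof.
move=> fc; apply: (@preimage_closed T R f [set x | x = c]) => [x _|]; first exact: fc.
exact: closed_eq.
Qed.

Lemma closed_preimage_ge (R : realType) (T : topologicalType) (f : T -> R) (c : R) :
  continuous f -> closed [set x | c <= f x].
Proof.
move=> fc; apply: (@preimage_closed T R f [set x | c <= x]) => [x _|]; first exact: fc.
exact: closed_ge.
Qed.

(* The space H is given by linear equations \tr (k *m A) = 0, so that it is
   visibly closed. *)
Lemma maxdet_exists (R : realType) m (H : 'M[R]_m -> Prop) (M0 : 'M[R]_m) c :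
  (exists K : set 'M[R]_m, forall A, H A <-> forall k, K k -> \tr (k *m A) = 0) ->
  H M0 -> semiposdefmx M0 -> \tr M0 = c ->
  exists M, [/\ H M, semiposdefmx M, \tr M = c &
    forall A, H A -> semiposdefmx A -> \tr A = c -> \det A <= \det M].
Proof.
move=> [K HK] HM0 M0p M0c.
(* Matrices are flattened to row vectors so that [rV_compact] applies to a box of entries. *)
pose V (v : 'rV[R]_(m * m)) : 'M[R]_m := vec_mx v.
have Vc i j : continuous (fun v => V v i j).
  rewrite (_ : (fun v => _) = fun v : 'rV_(m * m) => v 0 (mxvec_index i j)).
    exact: coord_continuous.
  by apply/funext => v; rewrite mxE.
have cstc q r (A : 'M[R]_(q, r)) i j : continuous (fun _ : 'rV[R]_(m * m) => A i j).
  exact: cst_continuous.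
have trc k : continuous (fun v => \tr (k *m V v)).
  by apply: continuous_sumr => i; exact: continuous_mulmx.
pose S := [set v | [/\ H (V v), semiposdefmx (V v) & \tr (V v) = c]].
have Sclosed : closed S.
  have -> : S = (\bigcap_(k in K) [set v | \tr (k *m V v) = 0])
     `&` ((\bigcap_(ij in [set: 'I_m * 'I_m]) [set v | V v ij.1 ij.2 - V v ij.2 ij.1 = 0])
     `&` (\bigcap_(u in [set: 'cV_m]) [set v | 0 <= (u^T *m V v *m u) 0 0]))
     `&` [set v | \tr (1%:M *m V v) = c].
    apply/seteqP; split => v /=.
      move=> [/HK hv [vs vp] vc]; split; last by rewrite mul1mx.
      split; first exact: hv.
      split=> [[i j] _|u _]/=; last exact: vp.
      by rewrite -{1}vs mxE subrr.
    move=> [[hv [vs vp]] vc]; split; [exact/HK| |by rewrite -vc mul1mx].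
    split=> [|u]; last exact: vp u I.
    by apply/matrixP => i j; rewrite mxE; have /eqP := vs (j, i) I; rewrite subr_eq0 => /eqP.
  apply: closedI; last by apply: closed_preimage_eq; exact: trc.
  apply: closedI.
    by apply: closed_bigI => k _; apply: closed_preimage_eq; exact: trc.
  apply: closedI; apply: closed_bigI.
    move=> [i j] _; apply: (@closed_preimage_eq _ _ (fun v => V v i j - V v j i)).
    by move=> x /=; apply: (@continuousB _ _ _ _ _ x); [exact: (Vc i j x)|exact: (Vc j i x)].
  move=> u _; apply: closed_preimage_ge; apply: continuous_mulmx => //.
  exact: continuous_mulmx.
(* By [semiposdefmx_entry_le] all entries lie between - c and c. *)
have Scompact : compact S.
  apply: (subclosed_compact Sclosed (rV_compact (fun=> @segment_compact R (- c) c))).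
  move=> v [_ vp vc] k /=.
  case/mxvec_indexP: k => i j.
  have := semiposdefmx_entry_le i j vp; rewrite vc ler_norml /V mxE.
  by rewrite in_itv.
have S0 : S !=set0 by exists (mxvec M0); rewrite /S /V /= mxvecK.
have [v vS vmax] := @compact_EVT_max _ R (fun v => \det (V v)) S S0 Scompact
  (continuous_subspaceT (continuous_det Vc)).
move: vS; rewrite inE => -[Hv vp vc]; exists (V v); split => // A HA Ap Ac.
have := vmax (mxvec A); rewrite inE /S /V /= mxvecK; exact.
Qed.

(** The case Q = 1 of the stationarity identity, for a maximizer among the matrices whose trace
    equals their size. *)
Lemma maxdet_normalized (R : realType) m (H : 'M[R]_m -> Prop) (M0 : 'M[R]_m) :
  (exists K : set 'M[R]_m, forall A, H A <-> forall k, K k -> \tr (k *m A) = 0) ->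
  (forall A, H A -> A^T = A) ->
  H M0 -> posdefmx M0 ->
  exists M, [/\ H M, posdefmx M & forall A, H A -> \tr (invmx M *m A) = \tr A].
Proof.
move=> HK Hsym HM0 M0p.
have Hlin A B a : H A -> H B -> H (A + a *: B).
  case: HK => K HK /HK HA /HK HB; apply/HK => k Kk.
  by rewrite mulmxDr -scalemxAr mxtraceD mxtraceZ HA// HB// mulr0 addr0.
(* In size 0 the trace of [M0] is 0 and cannot be normalized, but all traces are then empty sums. *)
case: m H M0 HK Hsym HM0 M0p Hlin => [|m] H M0 HK Hsym HM0 M0p Hlin.
  by exists M0; split => // A _; rewrite /mxtrace !big_ord0.
have HZ A a : H A -> H (a *: A).
  move=> HA; have -> : a *: A = A + (a - 1) *: A; last exact: Hlin.
  by rewrite scalerBl scale1r addrC subrK.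
have trM0 : 0 < \tr M0.
  rewrite /mxtrace big_ord_recl ltr_pwDl ?posdefmx_diag_gt0// sumr_ge0// => i _.
  exact/ltW/posdefmx_diag_gt0.
have N0 : 0 < m.+1%:R :> R by rewrite ltr0n.
pose a := m.+1%:R / \tr M0; have a0 : 0 < a by rewrite divr_gt0.
have M1p : posdefmx (a *: M0) := posdefmxZ a0 M0p.
have M1tr : \tr (a *: M0) = m.+1%:R by rewrite mxtraceZ divfK// gt_eqF.
have [M [HM Mp Mtr Mmax]] := maxdet_exists HK (HZ _ a HM0) (posdefmx_semi M1p) M1tr.
(* Comparison with the feasible multiple of [M0] makes the maximizer nonsingular, hence positive
   definite. *)
have detM : 0 < \det M.
  apply: lt_le_trans (posdefmx_det_gt0 M1p) (Mmax _ _ (posdefmx_semi M1p) M1tr).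
  exact: HZ.
have {}Mp : posdefmx M.
  by apply: semiposdefmx_unit Mp _; rewrite unitmxE unitfE gt_eqF.
exists M; split => //.
(* det (M + e A) = det M * det (1 + e A') is maximal at e = 0, and its
   derivative there is det M * \tr A'. *)
have crit A : H A -> \tr A = 0 -> \tr (invmx M *m A) = 0.
  move=> HA trA; have [B Bu MB] := posdefmx_cholesky Mp.
  pose A' := (invmx B)^T *m A *m invmx B.
  have BtVt : B^T *m (invmx B)^T = 1%:M by rewrite -trmx_mul mulVmx// trmx1.
  have AE e : M + e *: A = B^T *m (1%:M + e *: A') *m B.
    rewrite mulmxDr mulmxDl mulmx1 -MB -scalemxAr -scalemxAl /A' !mulmxA BtVt.
    by rewrite mul1mx mulmxKV.
  have A's : A'^T = A' by rewrite !trmx_mul trmxK (Hsym _ HA) mulmxA.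
  have -> : \tr (invmx M *m A) = \tr A'.
    have -> : invmx M = invmx B *m (invmx B)^T.
      have Mu := posdefmx_unit Mp.
      by apply: (can_inj (mulKmx Mu)); rewrite mulmxV// MB mulmxA mulmxK// BtVt.
    by rewrite -mulmxA mxtrace_mulC.
  have [d d0 pert] := semiposdefmx_perturb A's.
  have [r detr] := det_add1Z A'.
  apply: (critical_coef_eq0 (r := r) d0) => e /pert ep; rewrite -detr.
  have := Mmax (M + e *: A) (Hlin _ _ _ HM HA).
  rewrite {1}AE => /(_ (semiposdefmx_congr _ ep)).
  rewrite mxtraceD mxtraceZ trA mulr0 addr0 => /(_ Mtr).
  have -> : \det (M + e *: A) = \det M * \det (1%:M + e *: A').
    by rewrite AE MB !det_mulmx mulrAC.
  by rewrite ger_pMr.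
move=> A HA.
(* Subtracting the multiple of [M] with the same trace leaves a traceless matrix. Since \tr (M^-1 M)
   and \tr M are both the size, the two corrections agree. *)
have := crit (A + - (\tr A / m.+1%:R) *: M) (Hlin _ _ _ HA HM).
rewrite mxtraceD mxtraceZ Mtr mulNr divfK ?gt_eqF// subrr => /(_ erefl).
rewrite mulmxDr -scalemxAr mxtraceD mxtraceZ mulVmx ?posdefmx_unit// mxtrace1.
by rewrite mulNr divfK ?gt_eqF// => /eqP; rewrite subr_eq0 => /eqP.
Qed.

(* Writing Q = B^T B, the substitution A -> B A B^T reduces to Q = 1. *)
Lemma maxdet (R : realType) m (H : 'M[R]_m -> Prop) (M0 Q : 'M[R]_m) :
  (exists K : set 'M[R]_m, forall A, H A <-> forall k, K k -> \tr (k *m A) = 0) ->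
  (forall A, H A -> A^T = A) ->
  H M0 -> posdefmx M0 -> posdefmx Q ->
  exists M, [/\ H M, posdefmx M & forall A, H A -> \tr (invmx M *m A) = \tr (Q *m A)].
Proof.
move=> [K HK] Hsym HM0 M0p /posdefmx_cholesky[B Bu ->].
set C := invmx B; have Cu : C \in unitmx by rewrite unitmx_inv.
have CtBt : C^T *m B^T = 1%:M by rewrite -trmx_mul mulmxV// trmx1.
have BtCt : B^T *m C^T = 1%:M by rewrite -trmx_mul mulVmx// trmx1.
pose H' A := H (C *m A *m C^T).
have conjK A : C *m (B *m A *m B^T) *m C^T = A.
  by rewrite -!mulmxA BtCt mulmx1 mulKmx.
have conjK' A : B *m (C *m A *m C^T) *m B^T = A.
  by rewrite -!mulmxA CtBt mulmx1 mulKVmx.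
have H'K : exists K' : set 'M[R]_m, forall A, H' A <-> forall k, K' k -> \tr (k *m A) = 0.
  (* By cyclicity, \tr (k C A C^T) = \tr (C^T k C A), so the equations of [H] are conjugated. *)
  exists [set C^T *m k *m C | k in K] => A; rewrite /H' HK; split.
    by move=> h _ [k Kk <-]; rewrite -!mulmxA mxtrace_mulC -(h k Kk) !mulmxA.
  move=> h k Kk; rewrite -(h _ (imageP _ Kk)) -!mulmxA [RHS]mxtrace_mulC.
  by rewrite !mulmxA.
have H'sym A : H' A -> A^T = A.
  move=> /Hsym Xs; rewrite -(conjK' A).
  by move: (C *m A *m C^T) Xs => X Xs; rewrite !trmx_mul trmxK Xs mulmxA.
have [||M [HM Mp Mtr]] := maxdet_normalized H'K H'sym (M0 := B *m M0 *m B^T).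
- by rewrite /H' conjK.
- by rewrite -{1}[B]trmxK; apply: posdefmx_congr_unit => //; rewrite unitmx_tr.
have Mu := posdefmx_unit Mp.
exists (C *m M *m C^T); split => //.
  by rewrite -{1}[C]trmxK; apply: posdefmx_congr_unit => //; rewrite unitmx_tr.
move=> A HA.
have -> : invmx (C *m M *m C^T) = B^T *m invmx M *m B.
  have Xu : C *m M *m C^T \in unitmx by rewrite !unitmx_mul Cu Mu unitmx_tr.
  apply: (can_inj (mulKmx Xu)); rewrite mulmxV// -!mulmxA (mulmxA C^T) CtBt mul1mx.
  by rewrite mulKVmx// mulVmx.
have := Mtr (B *m A *m B^T); rewrite /H' conjK => /(_ HA).
have cyc (Z : 'M[R]_m) : \tr (B^T *m Z) = \tr (Z *m B^T) by exact: mxtrace_mulC.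
by rewrite -!mulmxA !cyc -!mulmxA.
Qed.

(** * Borel measurability of polynomials, and moments of a marginal *)

Lemma borel_continuous_measurable (R : realType) d (f : 'rV[R]_d -> R) :
  continuous f -> measurable_fun setT (f : borel R d -> R).
Proof.
move=> /continuousP fc; apply: (measurability _ (RGenOpens.measurableE R)).
move=> _ [_ [a [b ->] <-]]; rewrite setTI; apply: sub_sigma_algebra.
exact/fc/interval_open.
Qed.

Lemma borel_continuous_measurable_rV (R : realType) d e (f : 'rV[R]_d -> 'rV[R]_e) :
  continuous f -> measurable_fun setT (f : borel R d -> borel R e).
Proof.
move=> /continuousP fc.
apply: (@measurability _ _ (borel R d) (borel R e) _ _ (@open 'rV[R]_e)) => //.
by move=> _ [A Ao <-]; rewrite setTI; apply: sub_sigma_algebra; exact: fc.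
Qed.

Lemma continuous_meval (R : realType) (T : topologicalType) d
    (q : mpoly.mpoly d R) (g : 'I_d -> T -> R) :
  (forall i, continuous (g i)) ->
  continuous (fun x => mpoly.meval (fun i => g i x) q : R).
Proof.
move=> gc; pose c m : R := mpoly.mcoeff m q.
rewrite (_ : (fun x => _) = fun x =>
  \sum_(m <- mpoly.msupp q) c m * \prod_i g i x ^+ (mpoly.fun_of_multinom m i)).
  apply: continuous_sumr => m x; apply: cvgM; first exact: cvg_cst.
  apply: continuous_prodr => i {}x.
  apply: (@continuous_comp T R R (g i) (fun y : R => y ^+ mpoly.fun_of_multinom m i) x).
    exact: gc.
  exact: exprn_continuous.
by apply/funext => x; rewrite mpoly.mevalE.
Qed.

Lemma continuous_bpoly_eval (R : realType) d s (q : bpoly R d s) :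
  continuous (bpoly_eval q).
Proof. by apply: continuous_meval => i; exact: coord_continuous. Qed.

(** Change of variables: [phi] is the pushforward of [mu] under the projection to x. Integrability
    comes from [mu], because q composed with the projection is the polynomial [Q]. *)
Lemma moment_marginal (R : realType) n p
    (mu : {measure set (borel R (n + p)) -> \bar R})
    (phi : {measure set (borel R n) -> \bar R}) s s' (q : bpoly R n s)
    (Q : bpoly R (n + p) s') :
  finite_moments mu -> is_marginal mu phi ->
  (forall z, bpoly_eval Q z = bpoly_eval q (lsubmx z)) ->
  moment_functional phi q = moment_functional mu Q.
Proof.
move=> mu_fin marg Qq; rewrite /moment_functional /Rintegral; congr fine.
pose pr : borel R (n + p) -> borel R n := fun z => lsubmx (z : 'rV[R]_(n + p)).
have prm : measurable_fun setT pr.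
  apply: borel_continuous_measurable_rV.
  exact: continuous_lsubmx.
rewrite (@eq_measure_integral _ _ _ _ (pushforward mu pr)); last first.
  by move=> A Am _; rewrite marg.
rewrite integral_pushforward//.
- by apply: eq_integral => z _; rewrite /= Qq.
- by apply/measurable_EFinP; apply: borel_continuous_measurable; exact: continuous_bpoly_eval.
- have := mu_fin _ Q; congr (_.-integrable _ _).
  by apply/funext => z /=; rewrite Qq.
Qed.

Theorem mainTheorem2 (R : realType) (n p : nat) (hp : (1 < p)%N)
  (X : set 'rV[R]_n) (Y : set 'rV[R]_p) (Omega : set 'rV[R]_(n + p))
  (hOmegaXY : Omega `<=` [set z | X (lsubmx z) /\ Y (rsubmx z)])
  (hOmega_compact : compact Omega)
  (hOmega_int : interior Omega !=set0)
  (mu : {measure set (borel R (n + p)) -> \bar R})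
  (hmu_Omega : mu (~` Omega) = 0%E)
  (hmu_fin : finite_moments mu)
  (hmu_pos : forall t : nat,
      posdefmx (moment_matrix (@moment_functional R (n + p) mu t.*2)))
  (phi : {measure set (borel R n) -> \bar R})
  (hphi : is_marginal mu phi) :
  forall x : 'rV[R]_n, X x -> forall t : nat,
    exists nu : {scalar bpoly R p t.*2},
      posdefmx (moment_matrix nu) /\
      forall y : 'rV[R]_p,
        christoffel (@moment_functional R (n + p) mu t.*2) (row_mx x y) =
        christoffel (@moment_functional R n phi t.*2) x * christoffel nu y.
Proof.
move=> x _ t; set Mmu := moment_matrix (@moment_functional R (n + p) mu t.*2).
have Mmup : posdefmx Mmu := hmu_pos t.
(* The moment matrix of [phi] is the principal submatrix of [Mmu] on the monomials in x alone. *)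
have phip : posdefmx (moment_matrix (@moment_functional R n phi t.*2)).
  rewrite (_ : moment_matrix _ =
    mxsub (mindex_push (@lshift n p)) (mindex_push (@lshift n p)) Mmu).
    by apply: posdefmx_mxsub Mmup; apply: mindex_push_inj; exact: lshift_inj.
  apply/matrixP => i j; rewrite !mxE; apply: (moment_marginal hmu_fin hphi) => z.
  rewrite monomial2_push_eval; congr bpoly_eval; apply/rowP => k.
  by rewrite !mxE.
set c := christoffel _ x.
have c_gt0 : 0 < c := christoffel_gt0 x phip.
pose T := @specialize_mx R n p t x.
pose Q := c *: (T^T *m invmx Mmu *m T).
have Qp : posdefmx Q.
  apply: posdefmxZ c_gt0 _; apply: posdefmx_congr (posdefmx_inv Mmup) _ => u.
  exact: specialize_mx_inj.
(* The moment matrix of the y-marginal is read off [Mmu] without forming that measure. *)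
pose M0 := mxsub (mindex_push (@rshift n p)) (mindex_push (@rshift n p) (t := t)) Mmu.
have M0p : posdefmx M0.
  by apply: posdefmx_mxsub Mmup; apply: mindex_push_inj; exact: rshift_inj.
have [M [Mh Mp Mtr]] := maxdet (hankelmx_trace_eqs R p t) (@hankelmx_tr R p t)
  (hankelmx_moment_push _ _) M0p Qp.
exists (hankel_functional M); rewrite moment_matrix_hankel//; split => // y.
have tr11 (A : 'M[R]_1) : A 0 0 = \tr A by rewrite /mxtrace big_ord1.
(* Writing the form as a trace against v_t(y) v_t(y)^T brings it within reach of [Mtr]. *)
have trform A :
    ((monomials t y)^T *m A *m monomials t y) 0 0 =
    \tr (A *m (monomials t y *m (monomials t y)^T)).
  by rewrite tr11 -mulmxA mxtrace_mulC -mulmxA.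
rewrite [in RHS]/christoffel moment_matrix_hankel// trform Mtr; last exact: hankelmx_monomials.
(* The factor [c] put into [Q] cancels the value of the Christoffel function of [phi] at x. *)
rewrite -trform /Q -scalemxAr -scalemxAl mxE invfM mulrA divff ?gt_eqF// mul1r.
by rewrite /christoffel monomials_row_mx trmx_mul !mulmxA.
Qed.
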